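(* For all $n\ge2$ and $P,Q\in\Gamma_n$, the function $s\mapsto\mathcal W_s(P\Vert Q)$ is monotonically increasing (in the weak sense) on $s\ge-1$.
   Context: $\Gamma_n=\{P=(p_1,\dots,p_n): p_i>0,\ \sum_{i=1}^n p_i=1\}$. For $P,Q\in\Gamma_n$ and $s\in\mathbb{R}$, $$\mathcal W_s(P\Vert Q)=\begin{cases}[s(s-1)]^{-1}\left[\sum_{i=1}^n\left(\frac{p_i^{1-s}+q_i^{1-s}}{2}\right)\left(\frac{p_i+q_i}{2}\right)^s-1\right], & s\ne0,1,\\[4pt] \frac12\left[\sum_{i=1}^n p_i\ln\left(\frac{2p_i}{p_i+q_i}\right)+\sum_{i=1}^n q_i\ln\left(\frac{2q_i}{p_i+q_i}\right)\right], & s=0,\\[4pt] \sum_{i=1}^n\left(\frac{p_i+q_i}{2}\right)\ln\left(\frac{p_i+q_i}{2\sqrt{p_iq_i}}\right), & s=1.\end{cases}$$ *)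

(* Defs.v *)
From HB Require Import structures.
From mathcomp Require Import all_boot all_order all_algebra.
From mathcomp Require Import reals exp.

Set Implicit Arguments.
Unset Strict Implicit.
Unset Printing Implicit Defensive.

Import Order.TTheory GRing.Theory Num.Theory.
Local Open Scope ring_scope.

Definition Gamma (R : realType) (n : nat) (P : 'I_n -> R) : Prop :=
  (forall i, 0 < P i) /\ \sum_(i < n) P i = 1.

(* [`^] is the real power [powR]; on [Gamma] every base is positive, so the
   conventions for powers, logarithms and roots outside the positive reals
   play no role. *)
Definition W (R : realType) (n : nat) (P Q : 'I_n -> R) (s : R) : R :=
  if s == 0 then
    2^-1 * (\sum_(i < n) P i * ln (2 * P i / (P i + Q i))
            + \sum_(i < n) Q i * ln (2 * Q i / (P i + Q i)))
  else if s == 1 then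
    \sum_(i < n) (P i + Q i) / 2 *
      ln ((P i + Q i) / (2 * Num.sqrt (P i * Q i)))
  else
    (s * (s - 1))^-1 *
      (\sum_(i < n) (P i `^ (1 - s) + Q i `^ (1 - s)) / 2 *
                    ((P i + Q i) / 2) `^ s - 1).

(* Main.v *)
Require Import Defs.
From mathcomp Require Import all_boot all_order all_algebra.
From mathcomp Require Import reals exp.
From mathcomp Require Import ring lra.
From mathcomp Require Import classical_sets topology normedtype derive realfun.

Set Implicit Arguments.
Unset Strict Implicit.
Unset Printing Implicit Defensive.

Import Order.TTheory GRing.Theory Num.Theory.
Import numFieldNormedType.Exports.
Local Open Scope ring_scope.

(** The divergence is a symmetrised f-divergence from the midpoint.  With
    m_i = (p_i + q_i) / 2 it equals
      sum_i m_i (phi_s (p_i / m_i) + phi_s (q_i / m_i)) / 2,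
    where phi_s(x) = (x^(1-s) - 1) / (s (s-1)), replaced by x ln x at s = 0 and by
    - ln x at s = 1 ([W_kernelE]).  The point of this form is that
    phi_s''(x) = x^(-1-s) for every real s, so the three cases of the definition
    are treated at once from there on.

    The two arguments p_i / m_i and q_i / m_i add up to 2, so they are 1 + v
    and 1 - v with |v| < 1, and monotonicity in s already holds for each summand
    psi_s(v) = phi_s(1 + v) + phi_s(1 - v).  Indeed psi_s and its derivative in v
    vanish at v = 0, and psi_s''(v) = (1+v)^(-1-s) + (1-v)^(-1-s).  This second
    derivative is nondecreasing in s on s >= -1, because (1+v)(1-v) <= 1: raising
    s enlarges the term of the smaller base at least as much as it shrinks the other
    ([ler_powRN_sum]).  Integrating the inequality twice from v = 0
    ([ge0_of_derive2_ge0]) gives the monotonicity of psi_s. *)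

(** * Functions with nonnegative derivative *)

Lemma ge0_of_derive_ge0 (R : realType) (f df : R -> R) (b : R) :
  (forall x, 0 <= x < b -> is_derive x 1 f (df x)) ->
  (forall x, 0 <= x < b -> 0 <= df x) ->
  f 0 = 0 -> forall x, 0 <= x < b -> 0 <= f x.
Proof.
move=> fdf df0 f0 x /andP[x0 xb].
have sub y : y \in `[0, x] -> 0 <= y < b.
  by rewrite in_itv /= => /andP[-> yx]; exact: le_lt_trans yx xb.
have cf : ({within [set` `[0, x]%R], continuous f})%classic.
  apply: derivable_within_continuous => y /sub yb.
  exact: (@ex_derive _ _ _ _ _ _ _ (fdf y yb)).
have dI y : y \in `]0, x[ -> is_derive y 1 f (df y).
  by move=> yI; apply/fdf/sub/(subset_itv_oo_cc yI).
have [c /sub cb] := MVT_segment x0 dI cf.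
by rewrite f0 !subr0 => ->; rewrite mulr_ge0 ?df0.
Qed.

Lemma ge0_of_derive2_ge0 (R : realType) (f df d2f : R -> R) (b : R) :
  (forall x, 0 <= x < b -> is_derive x 1 f (df x)) ->
  (forall x, 0 <= x < b -> is_derive x 1 df (d2f x)) ->
  (forall x, 0 <= x < b -> 0 <= d2f x) ->
  f 0 = 0 -> df 0 = 0 -> forall x, 0 <= x < b -> 0 <= f x.
Proof.
move=> fdf dfd2f d2f0 f0 df0; apply: (ge0_of_derive_ge0 fdf) => //.
exact: (ge0_of_derive_ge0 dfd2f).
Qed.

(** * The power kernel *)

(** Normalised to vanish at 1 and to have second derivative x^(-1-s) for all s.
    The exceptional values are the limits of the generic one only up to a multiple
    of x - 1; such a multiple cancels in kernel s x + kernel s y when x + y = 2. *)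
Definition kernel (R : realType) (s x : R) : R :=
  if s == 0 then x * ln x
  else if s == 1 then - ln x
  else (s * (s - 1))^-1 * (x `^ (1 - s) - 1).

Definition dkernel (R : realType) (s x : R) : R :=
  if s == 0 then ln x + 1
  else if s == 1 then - x^-1
  else - s^-1 * x `^ (- s).

Lemma kernel1 (R : realType) (s : R) : kernel s 1 = 0.
Proof.
by rewrite /kernel ln1 powR1 subrr !mulr0 oppr0 !if_same.
Qed.

Lemma is_derive_kernel (R : realType) (s x : R) : 0 < x ->
  is_derive x 1 (kernel s) (dkernel s x).
Proof.
move=> x0; have dln := is_derive1_ln x0; have xN0 : x != 0 by rewrite gt_eqF.
rewrite /kernel /dkernel; case: eqVneq => [_|s0].
  by apply: is_derive_eq; rewrite /GRing.scale /= mulfV // mulr1 addrC.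
case: eqVneq => [_|s1]; first exact: is_deriveN.
have dpow := is_derive1_powR (1 - s) x0.
apply: is_derive_eq; rewrite /GRing.scale /= addrAC subrr add0r.
by have s10 : s - 1 != 0 by [rewrite subr_eq0]; field; rewrite s0 s10.
Qed.

Lemma is_derive_dkernel (R : realType) (s x : R) : 0 < x ->
  is_derive x 1 (dkernel s) (x `^ (- (1 + s))).
Proof.
move=> x0; have dln := is_derive1_ln x0; have xN0 : x != 0 by rewrite gt_eqF.
rewrite /dkernel; case: eqVneq => [->|s0].
  by rewrite addr0 powR_inv1 ?ltW //; apply: is_derive_eq; rewrite addr0.
case: eqVneq => [->|s1].
  rewrite (_ : 1 + 1 = 2%:R) // powR_invn ?ltW //.
  have dinv := is_deriveV xN0 (is_derive_id x 1).
  by apply: is_derive_eq; rewrite /GRing.scale /=; field.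
have dpow := is_derive1_powR (- s) x0.
apply: is_derive_eq; rewrite /GRing.scale /= opprD addrC.
by field.
Qed.

(** * Monotonicity of the symmetrised kernel *)

(** Going from exponent [- r] to [- (r + d)] multiplies the two terms by
    [x `^ - d <= 1] and [y `^ - d >= x `^ d >= 1].  The growth
    [y `^ - d - 1] dominates the loss [1 - x `^ - d] since
    [u + u^-1 >= 2], and it carries the larger weight [y `^ - r >= x `^ - r]. *)
Lemma ler_powRN_sum (R : realType) (x y r r' : R) :
  1 <= x -> 0 < y -> x * y <= 1 -> 0 <= r -> r <= r' ->
  x `^ (- r) + y `^ (- r) <= x `^ (- r') + y `^ (- r').
Proof.
move=> x1 y0 xy r0 rr'.
have [d d0 ->] : exists2 d, 0 <= d & r' = r + d.
  by exists (r' - r); rewrite ?subr_ge0 // addrC subrK.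
have x0 : 0 < x by exact: lt_le_trans x1.
have yVx : x <= y^-1 by rewrite -[leRHS]mul1r ler_pdivlMr.
have powNE z e : 0 < z -> z `^ (- e) = (z^-1) `^ e.
  by move=> z0; rewrite -powR_inv1 ?ltW // -powRrM mulN1r.
have le1 e : 0 <= e -> x `^ e <= y `^ (- e).
  by move=> e0; rewrite powNE // ge0_ler_powR // nnegrE ?invr_ge0 ltW.
have ge1 e : 0 <= e -> 1 <= x `^ e.
  by move=> e0; rewrite -[1](powRr0 x) ler_powR.
rewrite !opprD !powRD ?(gt_eqF x0) ?(gt_eqF y0) ?implybT //.
have := le1 _ d0; have := le1 _ r0; have := ge1 _ d0; have := ge1 _ r0.
rewrite !(powRN x).
set A := x `^ r; set B := y `^ (- r); set u := x `^ d; set w := y `^ (- d).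
move=> A1 u1 AB uw.
have A0 : 0 < A by exact: lt_le_trans A1.
have u0 : 0 < u by exact: lt_le_trans u1.
have AV1 : A^-1 <= 1 by rewrite invf_le1.
have AV0 : 0 < A^-1 by rewrite invr_gt0.
have uV1 : u^-1 <= 1 by rewrite invf_le1.
have uV : u * u^-1 = 1 by rewrite mulfV ?gt_eqF.
have loss_le_gain : 1 - u^-1 <= w - 1 by nra.
nra.
Qed.

(** Both sides, as functions of v, agree to first order at 0, so it suffices to
    compare second derivatives; s >= -1 makes the exponent 1 + s nonnegative. *)
Lemma ler_kernel_sum (R : realType) (s t v : R) :
  -1 <= s -> s <= t -> 0 <= v < 1 ->
  kernel s (1 + v) + kernel s (1 - v) <= kernel t (1 + v) + kernel t (1 - v).
Proof.
move=> s1 st v01.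
have dD (g dg : R -> R) (x : R) : is_derive (1 + x) 1 g (dg (1 + x)) ->
    is_derive x 1 (fun z => g (1 + z)) (dg (1 + x)).
  move=> dgx; have dsum : is_derive x 1 (fun z : R => 1 + z) 1.
    by apply: is_derive_eq; rewrite mulr1 add0r.
  by apply: is_derive_eq (is_derive1_comp (g := fun z => 1 + z) dgx dsum) _; rewrite mulr1.
have dB (g dg : R -> R) (x : R) : is_derive (1 - x) 1 g (dg (1 - x)) ->
    is_derive x 1 (fun z => g (1 - z)) (- dg (1 - x)).
  move=> dgx; have ddiff : is_derive x 1 (fun z : R => 1 - z) (-1).
    by apply: is_derive_eq; rewrite add0r mul1r.
  by apply: is_derive_eq (is_derive1_comp (g := fun z => 1 - z) dgx ddiff) _; rewrite mulrN1.
pose psi (k : R) (x : R) := kernel k (1 + x) + kernel k (1 - x).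
pose d (k : R) (x : R) := dkernel k (1 + x) - dkernel k (1 - x).
pose d2 (k : R) (x : R) := (1 + x) `^ (- (1 + k)) + (1 - x) `^ (- (1 + k)).
rewrite -subr_ge0; move: v v01.
apply: (@ge0_of_derive2_ge0 _ (fun x => psi t x - psi s x)
  (fun x => d t x - d s x) (fun x => d2 t x - d2 s x)) => [x x01|x x01|x x01||].
- have [xp xm] : 0 < 1 + x /\ 0 < 1 - x by lra.
  have D1 k := @dD _ _ _ (is_derive_kernel k xp).
  have D2 k := @dB _ _ _ (is_derive_kernel k xm).
  by apply: is_deriveB; apply: is_deriveD.
- have [xp xm] : 0 < 1 + x /\ 0 < 1 - x by lra.
  have D1 k := @dD _ (fun y => y `^ (- (1 + k))) _ (is_derive_dkernel k xp).
  have D2 k := @dB _ (fun y => y `^ (- (1 + k))) _ (is_derive_dkernel k xm).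
  by rewrite /d /d2; apply: is_deriveB; apply: is_derive_eq; rewrite opprK.
- by rewrite subr_ge0; apply: ler_powRN_sum; nra.
- by rewrite /psi addr0 subr0 !kernel1 !addr0 subrr.
- by rewrite /d addr0 subr0 !subrr.
Qed.

(** * The divergence as a mean of kernels *)

(** For s other than 0 and 1 this holds because
    m (p / m)^(1-s) = p^(1-s) m^s; for s = 1, the logarithm of
    m / sqrt (p q) is minus the mean of those of p / m and q / m. *)
Lemma W_kernelE (R : realType) (n : nat) (P Q : 'I_n -> R) (s : R) :
  Gamma P -> Gamma Q ->
  W P Q s = \sum_(i < n) (P i + Q i) / 2 *
    ((kernel s (P i / ((P i + Q i) / 2)) + kernel s (Q i / ((P i + Q i) / 2))) / 2).
Proof.
move=> [P0 P1] [Q0 Q1].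
have m0 i : 0 < (P i + Q i) / 2 by rewrite divr_gt0 ?addr_gt0.
rewrite /W /kernel; case: eqVneq => [_|s0].
  rewrite -big_split /= big_distrr; apply: eq_bigr => i _ /=.
  have PQ0 : P i + Q i != 0 by rewrite gt_eqF ?addr_gt0.
  rewrite (_ : 2 * P i / (P i + Q i) = P i / ((P i + Q i) / 2)); last by field.
  rewrite (_ : 2 * Q i / (P i + Q i) = Q i / ((P i + Q i) / 2)); last by field.
  set lP := ln _; set lQ := ln _.
  by field.
case: eqVneq => [_|s1].
  apply: eq_bigr => i _; congr (_ * _).
  have S0 : 0 < Num.sqrt (P i * Q i) by rewrite sqrtr_gt0 mulr_gt0.
  rewrite invfM mulrA -/((P i + Q i) / 2) !ln_div ?posrE ?addr_gt0 //.
  rewrite -powR12_sqrt ?mulr_ge0 ?ltW // ln_powR lnM ?posrE //.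
  by field.
(* the masses [m_i] sum to 1, which accounts for the constant [- 1] *)
have sum_m : \sum_(i < n) (P i + Q i) / 2 = 1.
  by rewrite -mulr_suml big_split /= P1 Q1; field.
rewrite -[X in _ * (_ - X)]sum_m -sumrB big_distrr; apply: eq_bigr => i _ /=.
move: (m0 i); set m := (P i + Q i) / 2; clearbody m => mgt0.
have mN0 : m != 0 by rewrite gt_eqF.
have powE z : 0 < z -> z `^ (1 - s) * m `^ s = m * (z / m) `^ (1 - s).
  move=> z0; rewrite powRM ?invr_ge0 ?(ltW z0) ?(ltW mgt0) //.
  rewrite -(powR_inv1 (ltW mgt0)) -powRrM mulN1r opprB mulrCA.
  rewrite (@powRB _ m) ?mN0 ?implybT // powRr1 ?(ltW mgt0) //.
  by rewrite (mulrCA m) mulfV // mulr1.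
rewrite -(mulrAC _ (m `^ s)) mulrDl !powE //.
by field; rewrite s0 subr_eq0 s1.
Qed.

Theorem mainTheorem6 (R : realType) (n : nat) (hn : (2 <= n)%N)
    (P Q : 'I_n -> R) (hP : Gamma P) (hQ : Gamma Q) :
  {in `[-1, +oo[ &, {homo W P Q : s t / s <= t}}.
Proof.
move=> s t; rewrite !in_itv /= !andbT => s1 _ st.
rewrite !W_kernelE //; apply: ler_sum => i _.
have [[/(_ i) p0 _] [/(_ i) q0 _]] := (hP, hQ).
(* by symmetry the larger of the two ratios can be taken to be 1 + v with v >= 0 *)
have kernel_le (p q : R) : 0 < q -> q <= p ->
    kernel s (p / ((p + q) / 2)) + kernel s (q / ((p + q) / 2)) <=
    kernel t (p / ((p + q) / 2)) + kernel t (q / ((p + q) / 2)).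
  move=> q_gt0 qp.
  have pq0 : 0 < p + q by lra.
  have pqN0 : p + q != 0 by rewrite gt_eqF.
  rewrite (_ : p / _ = 1 + (p - q) / (p + q)); last by field.
  rewrite (_ : q / _ = 1 - (p - q) / (p + q)); last by field.
  apply: ler_kernel_sum => //.
  by rewrite divr_ge0 ?ltr_pdivrMr ?mul1r /=; lra.
rewrite ler_pM2l ?divr_gt0 ?addr_gt0 // ler_pM2r ?invr_gt0 //.
have [pq|/ltW qp] := leP (P i) (Q i); last exact: kernel_le.
by rewrite (addrC (P i)) ![kernel _ (P i / _) + _]addrC; exact: kernel_le.
Qed.
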